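(* Let $G\in L^2(\gamma)$ and let $Y$ be a standard Gaussian random variable. Then the power rank of $G$ with respect to $Y$ coincides with the Hermite rank of $G$.
   Context: $\gamma(dx)=\phi(x)\,dx$ with $\phi(x)=(2\pi)^{-1/2}e^{-x^2/2}$ is the standard Gaussian measure on $\mathbb{R}$, and $L^2(\gamma)=\{G:\mathbb{R}\to\mathbb{R}\ \text{measurable}:\int_{\mathbb{R}}G(z)^2\phi(z)\,dz<\infty\}$. Power rank: given $G$ and a random variable $Y$ with $\mathbb{E}\,G(Y)^2<\infty$, let $G_\infty(y)=\mathbb{E}\,G(Y+y)$, assuming the expectation exists and that $G_\infty$ has derivatives of sufficiently high order. The power rank of $G$ with respect to $Y$ is $\inf\{m\ge1:\ G_\infty^{(m)}(0)\neq0\}$, where $G_\infty^{(m)}$ is the $m$-th derivative of $G_\infty$. Hermite rank: the Hermite polynomials are $H_0(x)=1$, $H_m(x)=(-1)^m e^{x^2/2}\frac{d^m}{dx^m}e^{-x^2/2}$ for $m\ge1$; the Hermite rank of $G\in L^2(\gamma)$ is $\inf\{m\ge 1:\int_{\mathbb{R}} G(x)H_m(x)\,\gamma(dx)\ne 0\}$. In both definitions $\inf\emptyset=\infty$. *)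

(* Defs.v *)
From mathcomp Require Import all_boot all_order all_algebra.
From mathcomp Require Import all_classical all_reals all_analysis.

Set Implicit Arguments.
Unset Strict Implicit.
Unset Printing Implicit Defensive.

Import Order.TTheory GRing.Theory Num.Theory.
Import numFieldNormedType.Exports.

Local Open Scope classical_set_scope.
Local Open Scope ring_scope.

(* The library's [normal_prob] takes the mean and the standard deviation. *)
Notation gauss R := (normal_prob (0 : R) (1 : R)).

(* Only measurable sets are compared: a measure of the library is a function on
   all sets, and its values on non-measurable ones are arbitrary. *)
Definition standard_gaussian (R : realType) d (T : measurableType d)
    (P : probability T R) (Y : {RV P >-> R}) : Prop :=
  forall A : set R, measurable A -> distribution P Y A = gauss R A.

(* [inf {m >= 1 : c m <> 0}] in the extended reals; it is [+oo] if no such [m]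
   exists. *)
Definition rank (R : realType) (c : nat -> \bar R) : \bar R :=
  ereal_inf [set (m%:R)%:E | m in [set m : nat | (1 <= m)%N /\ c m <> 0%E]].

Section PowerRank.
Context (R : realType) d (T : measurableType d) (P : probability T R).
Variables (Y : {RV P >-> R}) (G : R -> R).

Definition shifted_mean (y : R) : R := fine ('E_P[fun w => G (Y w + y)])%E.

(* [fine] and iterated derivatives are total functions: [power_rank] is only
   meaningful under [has_power_rank]. *)
Definition has_power_rank : Prop :=
  [/\ G \o Y \in Lfun P 2%:E,
      forall y : R, P.-integrable setT (fun w => (G (Y w + y))%:E)
    & forall (n : nat) (y : R), derivable (shifted_mean^`(n))%classic y 1].

Definition power_rank : \bar R :=
  rank (fun m => ((shifted_mean^`(m))%classic 0)%:E).

End PowerRank.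

(* For [m = 0] the formula gives [1], see [hermite0]. *)
Definition hermite (R : realType) (m : nat) (x : R) : R :=
  (-1) ^+ m * expR (x ^+ 2 / 2) *
    ((fun t : R => expR (- (t ^+ 2 / 2)))^`(m))%classic x.

Lemma hermite0 (R : realType) (x : R) : hermite 0 x = 1.
Proof. by rewrite /hermite expr0 mul1r derive1n0 -expRD subrr expR0. Qed.

Definition hermite_rank (R : realType) (G : R -> R) : \bar R :=
  rank (fun m => \int[gauss R]_x (G x * hermite m x)%:E)%E.

(* Main.v *)
Require Import Defs.
From mathcomp Require Import all_boot all_order all_algebra.
From mathcomp Require Import all_classical all_reals all_analysis.
From mathcomp Require Import measurable_realfun lra.

(** Translating the variable instead of the function,
      [E G(Y + y) = \int G(x) phi(x - y) dx],
    moves all the dependence on [y] into the Gaussian density, so that the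
    smoothness of [G_infty] does not require any smoothness of [G]. The [n]-th
    derivative of [y |-> phi(x - y)] is [H_n(x - y) phi(x - y)]
    ([is_derive_hermite_kernel]), hence, once differentiation under the integral
    sign is justified,
      [G_infty^(n)(y) = \int G(x) H_n(x - y) phi(x - y) dx]
    ([derive1n_hermite_transform]). At [y = 0] the right-hand side is the
    [n]-th Hermite coefficient [\int G H_n dgamma] ([integral_hermite]). The two
    ranks are thus infima of one and the same set of indices.

    The domination needed to differentiate comes from [G \in L^2(gamma)]: for
    [|y| <= M] one has [|H_n(x - y)| <= C e^(|x| + M)] and
    [phi(x - y) <= e^(M |x|) phi(x)], so every integrand is bounded by a multiple
    of [|G(x)| e^(c |x|) phi(x)], and [|G| e^(c |x|) <= G^2 + e^(2 c |x|)] is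
    [gamma]-integrable since a Gaussian has all exponential moments
    ([hermite_kernel_bound], [integrable_mul_expR_normal_pdf]). *)

Set Implicit Arguments.
Unset Strict Implicit.
Unset Printing Implicit Defensive.

Import Order.TTheory GRing.Theory Num.Theory.
Import numFieldNormedType.Exports.

Local Open Scope classical_set_scope.
Local Open Scope ring_scope.

(** * Hermite polynomials *)

(** The recurrence [H_(n+1) = X H_n - H_n'] exhibits the Hermite functions as
    polynomials, which gives measurability and growth bounds at once; see
    [hermiteE] for the agreement with the Rodrigues formula. *)
Fixpoint hermite_poly (R : realType) (n : nat) : {poly R} :=
  if n is m.+1 then 'X * hermite_poly R m - (hermite_poly R m)^`() else 1.

Lemma is_derive_hermite_poly_gauss (R : realType) (n : nat) (t : R) :
  is_derive t 1 (fun t => (hermite_poly R n).[t] * expR (- (t ^+ 2 / 2)))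
    (- ((hermite_poly R n.+1).[t] * expR (- (t ^+ 2 / 2)))).
Proof.
have dq : is_derive t 1 (fun t : R => - (t ^+ 2 / 2)) (- t).
  apply: is_derive_eq; rewrite /GRing.scale/=; lra.
have de := @is_derive1_comp _ expR (fun t : R => - (t ^+ 2 / 2)) t _ _
  (is_derive_expR _) dq.
have := is_deriveM (is_derive_poly (hermite_poly R n) t) de => dM.
apply: (is_derive_eq dM).
by rewrite /= hornerD hornerN hornerM hornerX /GRing.scale/=; lra.
Qed.

Lemma derive1n_gauss (R : realType) (n : nat) :
  (fun t : R => expR (- (t ^+ 2 / 2)))^`(n)%classic =
  fun t : R => (-1) ^+ n * ((hermite_poly R n).[t] * expR (- (t ^+ 2 / 2))).
Proof.
elim: n => [|n ih]; first by apply/funext => t; rewrite derive1n0 hornerC !mul1r.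
apply/funext => t; rewrite derive1nS ih derive1E.
have d := is_derive_hermite_poly_gauss n t.
rewrite (_ : (fun _ => _) = (-1) ^+ n \*:
  (fun t => (hermite_poly R n).[t] * expR (- (t ^+ 2 / 2))))//.
rewrite deriveZ; last exact: ex_derive.
by rewrite derive_val scalerN (exprS (-1) n) mulN1r mulNr.
Qed.

Lemma hermiteE (R : realType) (n : nat) (x : R) :
  hermite n x = (hermite_poly R n).[x].
Proof.
rewrite /hermite derive1n_gauss mulrACA -exprMn mulrNN mulr1 expr1n mul1r.
by rewrite mulrCA -expRD subrr expR0 mulr1.
Qed.

(** Each monomial satisfies [|t|^i <= i! e^|t|], by the exponential series. *)
Lemma horner_le_expR (R : realType) (p : {poly R}) :
  exists2 C : R, 0 <= C & forall t, `|p.[t]| <= C * expR `|t|.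
Proof.
exists (\sum_(i < size p) `|p`_i| * i`!%:R); first exact: sumr_ge0.
move=> t; rewrite horner_coef (le_trans (ler_norm_sum _ _ _))// mulr_suml.
apply: ler_sum => i _; rewrite normrM normrX -mulrA ler_wpM2l//.
case: (nat_of_ord i) => [|n].
  by rewrite expr0 fact0 mul1r -expR0 ler_expR.
rewrite -ler_pdivrMl ?ltr0n ?fact_gt0// mulrC.
by have := @expR_ge1Dxn R `|t| n (normr_ge0 _); lra.
Qed.

Lemma measurable_horner (R : realType) (p : {poly R}) :
  measurable_fun setT (horner p).
Proof. by apply: continuous_measurable_fun; exact: continuous_horner. Qed.

Lemma measurable_fun_Lfun d (T : measurableType d) (R : realType)
    (mu : {measure set T -> \bar R}) (p : \bar R) (f : T -> R) :
  f \in Lfun mu p -> measurable_fun setT f.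
Proof. by move=> /sub_Lfun_mfun; rewrite inE. Qed.

(** * Integration against Gaussian laws *)

Section normal_prob_integral.
Context (R : realType) (m s : R).
Local Notation mu := (@lebesgue_measure R).
Local Open Scope ereal_scope.

(** The Radon-Nikodym derivative of a normal law is only known to exist; its
    integrals over measurable sets are those of [normal_pdf], hence the two agree
    almost everywhere. *)
Lemma ge0_integral_normal_prob (f : measurableTypeR R -> \bar R) :
  measurable_fun setT f -> (forall x, 0 <= f x) ->
  \int[normal_prob m s]_x f x = \int[mu]_x (f x * (normal_pdf m s x)%:E).
Proof.
move=> mf f0; have dom := normal_prob_dominates m s.
have mpdf : measurable_fun setT (EFin \o normal_pdf m s).
  by apply/measurable_EFinP; exact: measurable_normal_pdf.
rewrite -(Radon_Nikodym_SigmaFinite.change_of_variables dom)//.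
have intf := Radon_Nikodym_SigmaFinite.f_integrable dom.
have mRN := measurable_int _ intf.
apply: ae_eq_integral => //; [exact: emeasurable_funM..|].
apply: ae_eqe_mul2l; apply: integral_ae_eq => // E _ mE.
by rewrite -Radon_Nikodym_SigmaFinite.f_integral.
Qed.

Lemma integrable_normal_prob (f : measurableTypeR R -> \bar R) :
  measurable_fun setT f ->
  mu.-integrable setT (fun x => f x * (normal_pdf m s x)%:E) ->
  (normal_prob m s).-integrable setT f.
Proof.
move=> mf /integrableP[_ foo]; apply/integrableP; split => //.
rewrite ge0_integral_normal_prob//; last exact: measurableT_comp.
rewrite (le_lt_trans _ foo)// le_eqVlt; apply/orP; left; apply/eqP.
apply: eq_integral => x _.
by rewrite abseM [X in _ = _ * X]gee0_abs// lee_fin normal_pdf_ge0.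
Qed.

(** Multiplying by a nonnegative density commutes with taking positive and
    negative parts, which reduces the signed case to the nonnegative one. *)
Lemma integral_normal_prob (f : measurableTypeR R -> \bar R) :
  measurable_fun setT f ->
  \int[normal_prob m s]_x f x = \int[mu]_x (f x * (normal_pdf m s x)%:E).
Proof.
move=> mf; have p0 x : 0 <= (normal_pdf m s x)%:E.
  by rewrite lee_fin normal_pdf_ge0.
rewrite integralE [RHS]integralE; congr (_ - _).
- rewrite ge0_integral_normal_prob//; last exact: measurable_funepos.
  apply: eq_integral => x _.
  by rewrite !funeposE maxe_pMl// mul0e.
- rewrite ge0_integral_normal_prob//; last exact: measurable_funeneg.
  apply: eq_integral => x _.
  by rewrite !funenegE maxe_pMl// mul0e mulNe.
Qed.

End normal_prob_integral.

Lemma pushforward_lebesgue_shift (R : realType) (y : R) (A : set R) :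
  measurable A ->
  pushforward (@lebesgue_measure R) (fun x : measurableTypeR R => x + y) A =
  lebesgue_measure A.
Proof.
pose translate (x : measurableTypeR R) : measurableTypeR R := x + y.
have mtranslate : measurable_fun setT translate by exact: measurable_funD.
move=> mA; apply/esym.
apply: (@lebesgue_measure_unique R (pushforward lebesgue_measure translate))
  => //= _ [[a b]] _ <-.
rewrite /pushforward (_ : _ @^-1` _ = `](a - y)%R, (b - y)%R]%classic); last first.
  by apply/seteqP; split => x /=; rewrite !in_itv/= ltrBlDr lerBrDr.
rewrite !lebesgue_measure_itv/= !lte_fin ltrD2r.
by case: ifP => // _; congr EFin; lra.
Qed.

(** Translation invariance of the Lebesgue measure turns a translation of the
    variable into a translation of the density. *)
Lemma normal_prob_shift (R : realType) (y : R) (A : set R) : measurable A ->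
  normal_prob 0 1 ((fun x => x + y) @^-1` A) = normal_prob y 1 A.
Proof.
move=> mA; rewrite /normal_prob.
pose translate (x : measurableTypeR R) : measurableTypeR R := x + y.
have mtranslate : measurable_fun setT translate by exact: measurable_funD.
transitivity (\int[pushforward lebesgue_measure translate]_(x in A)
    (normal_pdf y 1 x)%:E)%E; last first.
  by apply: eq_measure_integral => B mB _; exact: pushforward_lebesgue_shift.
rewrite ge0_integral_pushforward//.
- apply: eq_integral => x _; congr EFin.
  by rewrite !normal_pdfE ?oner_neq0// /normal_fun/= subr0 addrK.
- by apply/measurable_EFinP/measurable_funTS; exact: measurable_normal_pdf.
- by move=> x _; rewrite lee_fin normal_pdf_ge0.
Qed.

Section standard_gaussian_law.
Context (R : realType) d (T : measurableType d) (P : probability T R).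
Variables (Y : {RV P >-> R}).
Hypothesis gY : standard_gaussian Y.
Variable y : R.
Local Open Scope ereal_scope.

Let mshift : measurable_fun setT (fun w => (Y w + y)%R : measurableTypeR R).
Proof. exact: measurable_funD. Qed.

Let lawE (A : set (measurableTypeR R)) : measurable A -> A `<=` setT ->
  pushforward P (fun w => (Y w + y)%R : measurableTypeR R) A = normal_prob y 1 A.
Proof.
move=> mA _; rewrite -normal_prob_shift// -gY//.
rewrite -[X in measurable X]setTI; exact: measurable_funD.
Qed.

Lemma integral_standard_gaussian (f : measurableTypeR R -> \bar R) :
  measurable_fun setT f ->
  \int[P]_w f (Y w + y)%R =
  \int[lebesgue_measure]_x (f x * (normal_pdf y 1 x)%:E).
Proof.
move=> mf; rewrite -integral_normal_prob//.
rewrite integralE [RHS]integralE; congr (_ - _).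
- rewrite -(eq_measure_integral _ lawE) ge0_integral_pushforward//;
    last exact: measurable_funepos.
  by apply: eq_integral => w _; rewrite /= !funeposE.
- rewrite -(eq_measure_integral _ lawE) ge0_integral_pushforward//;
    last exact: measurable_funeneg.
  by apply: eq_integral => w _; rewrite /= !funenegE.
Qed.

Lemma integrable_standard_gaussian (f : measurableTypeR R -> \bar R) :
  measurable_fun setT f ->
  lebesgue_measure.-integrable setT (fun x => f x * (normal_pdf y 1 x)%:E) ->
  P.-integrable setT (fun w => f (Y w + y)%R).
Proof.
move=> mf /(integrable_normal_prob mf)/integrableP[_ foo].
apply/integrableP; split; first exact: measurableT_comp.
rewrite (@integral_standard_gaussian (abse \o f)).
  by rewrite -integral_normal_prob//; exact: measurableT_comp.
exact: measurableT_comp.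
Qed.

End standard_gaussian_law.

(** * Derivatives of the translated Gaussian density *)

Section gaussian_kernel.
Context (R : realType).
Local Notation mu := (@lebesgue_measure R).

Lemma normal_pdf1E (y x : R) :
  normal_pdf y 1 x = normal_peak 1 * expR (- ((x - y) ^+ 2 / 2)).
Proof. by rewrite normal_pdfE ?oner_neq0// /normal_fun expr1n mulNr. Qed.

Lemma normal_pdf_expR (y x : R) :
  normal_pdf y 1 x = expR (x * y - y ^+ 2 / 2) * normal_pdf 0 1 x.
Proof.
rewrite !normal_pdf1E mulrCA -expRD subr0; congr (_ * expR _); lra.
Qed.

(** Multiplying [phi] by [e^(b x)] gives the density of mean [b], up to a
    constant: completing the square yields the exponential moments. *)
Lemma integrable_expR_norm_normal_pdf (c : R) :
  mu.-integrable setT (fun x => (expR (c * `|x|) * normal_pdf 0 1 x)%:E).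
Proof.
have tiltE (b x : R) :
    expR (b * x) * normal_pdf 0 1 x = expR (b ^+ 2 / 2) * normal_pdf b 1 x.
  by rewrite [in RHS]normal_pdf_expR mulrA -expRD; congr (expR _ * _); lra.
have inttilt b : mu.-integrable setT
    (fun x => (expR (b * x) * normal_pdf 0 1 x)%:E).
  under eq_fun do rewrite tiltE EFinM.
  by apply: integrableZl => //; exact: integrable_normal_pdf.
apply: le_integrable (integrableD _ (inttilt c) (inttilt (- c))) => //.
  apply/measurable_EFinP; apply: measurable_funM => //.
    by apply: measurableT_comp => //; exact: measurable_funM.
  exact: measurable_normal_pdf.
move=> x _; rewrite -EFinD !abse_EFin lee_fin -mulrDl.
rewrite ger0_norm; last by rewrite mulr_ge0 ?expR_ge0 ?normal_pdf_ge0.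
rewrite ger0_norm; last by rewrite mulr_ge0 ?addr_ge0 ?expR_ge0 ?normal_pdf_ge0.
rewrite ler_wpM2r ?normal_pdf_ge0//.
by have [_|_] := ger0P x; rewrite ?mulrN ?mulNr ?lerDl ?lerDr expR_ge0.
Qed.

(** Pointwise [|G| e^(c |x|) <= G^2 + e^(2 c |x|)]. *)
Lemma integrable_mul_expR_normal_pdf (G : R -> R) (c : R) :
  G \in Lfun (gauss R) 2%:E ->
  mu.-integrable setT
    (fun x => (`|G x| * (expR (c * `|x|) * normal_pdf 0 1 x))%:E).
Proof.
move=> LG; have mG := measurable_fun_Lfun LG.
have intG2 : mu.-integrable setT (fun x => (G x ^+ 2 * normal_pdf 0 1 x)%:E).
  have /integrableP[mG2 foo] := Lfun2_integrable_sqr LG.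
  apply/integrableP; split.
    apply/measurable_EFinP/measurable_funM; last exact: measurable_normal_pdf.
    exact: measurable_funX.
  rewrite ge0_integral_normal_prob// in foo; last exact: measurableT_comp.
  rewrite (le_lt_trans _ foo)// le_eqVlt; apply/orP; left; apply/eqP.
  apply: eq_integral => x _.
  by rewrite EFinM abseM [X in (_ * X)%E]gee0_abs// lee_fin normal_pdf_ge0.
apply: le_integrable (integrableD _ intG2
  (integrable_expR_norm_normal_pdf (c + c))) => //.
  apply/measurable_EFinP; apply: measurable_funM; first exact: measurableT_comp.
  apply: measurable_funM; last exact: measurable_normal_pdf.
  apply: measurableT_comp => //; apply: measurable_funM => //.
move=> x _; rewrite -EFinD !abse_EFin lee_fin mulrA -mulrDl (mulrDl c) expRD.
set e := expR _.
have e0 : 0 <= e by exact: expR_ge0.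
have G0 := normr_ge0 (G x).
rewrite -(real_normK (num_real (G x))).
rewrite !normrM !(@ger0_norm _ (normal_pdf 0 1 x)) ?normal_pdf_ge0//.
rewrite ler_wpM2r ?normal_pdf_ge0// normr_id (ger0_norm e0) ger0_norm; nra.
Qed.

(** The [n]-th derivative in [y] of the density [normal_pdf y 1 x], see
    [is_derive_hermite_kernel]. *)
Definition hermite_kernel (n : nat) (y x : R) : R :=
  (hermite_poly R n).[x - y] * normal_pdf y 1 x.

(** Differentiating [H_n(t) e^(-t^2/2)] produces a minus sign, and so does the
    inner derivative of [t = x - y]; the two cancel. *)
Lemma is_derive_hermite_kernel (n : nat) (x y : R) :
  is_derive y 1 (hermite_kernel n ^~ x) (hermite_kernel n.+1 y x).
Proof.
have dsub : is_derive y 1 (fun y : R => x - y) (- 1).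
  have := is_deriveB (is_derive_cst x y 1) (is_derive_id y 1).
  by rewrite sub0r.
have := @is_derive1_comp _ _ (fun y : R => x - y) y _ _
  (is_derive_hermite_poly_gauss n (x - y)) dsub.
rewrite mulrN1 opprK => d.
have := is_deriveZ (normal_peak (1 : R)) d.
rewrite (_ : _ \*: _ = hermite_kernel n ^~ x); last first.
  by apply/funext => z; rewrite /hermite_kernel normal_pdf1E mulrCA.
by rewrite /hermite_kernel normal_pdf1E mulrCA.
Qed.

(** Uniformity in [y] over bounded sets is what dominated convergence needs. *)
Lemma hermite_kernel_bound (n : nat) (M : R) : exists2 C : R, 0 <= C &
  forall y x : R, `|y| <= M -> `|hermite_kernel n y x| <=
    C * (expR ((M + 1) * `|x|) * normal_pdf 0 1 x).
Proof.
have [C C0 Cp] := horner_le_expR (hermite_poly R n).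
exists (C * expR M); first by rewrite mulr_ge0 ?expR_ge0.
move=> y x yM; rewrite /hermite_kernel normrM.
rewrite [X in _ * X]ger0_norm ?normal_pdf_ge0// normal_pdf_expR !mulrA.
rewrite ler_wpM2r ?normal_pdf_ge0//.
apply: le_trans (ler_wpM2r (expR_ge0 _) (Cp _)) _.
rewrite -!mulrA ler_wpM2l// -!expRD ler_expR.
have xy : x * y <= M * `|x|.
  rewrite (le_trans (ler_norm _))// normrM mulrC ler_wpM2r//.
have := ler_normB x y; have := sqr_ge0 y; lra.
Qed.

Lemma measurable_hermite_kernel (n : nat) (y : R) :
  measurable_fun setT (hermite_kernel n y).
Proof.
apply: measurable_funM; last exact: measurable_normal_pdf.
apply: (measurableT_comp (measurable_horner (hermite_poly R n))).
exact: measurable_funB.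
Qed.

End gaussian_kernel.

(** * Differentiation under the integral sign *)

Section hermite_transform.
Context (R : realType) (G : R -> R).
Hypothesis LG : G \in Lfun (gauss R) 2%:E.
Local Notation mu := (@lebesgue_measure R).

(** For a standard Gaussian [Y] this is [E (G(Y + y) H_n(Y))]: the smoothed
    function [G_infty] for [n = 0], and the [n]-th Hermite coefficient of [G] at
    [y = 0]. *)
Definition hermite_transform (n : nat) (y : R) : R :=
  \int[mu]_x (G x * hermite_kernel n y x).

Let mG : measurable_fun setT G := measurable_fun_Lfun LG.

Lemma integrable_mul_hermite_kernel (n : nat) (y : R) :
  mu.-integrable setT (fun x => (G x * hermite_kernel n y x)%:E).
Proof.
have [C C0 CK] := hermite_kernel_bound n `|y|.
apply: le_integrable
  (integrableZl _ C (integrable_mul_expR_normal_pdf (`|y| + 1) LG)) => //.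
  apply/measurable_EFinP/measurable_funM => //.
  exact: measurable_hermite_kernel.
move=> x _; rewrite -EFinM !abse_EFin lee_fin.
by rewrite (le_trans _ (ler_norm _))// normrM mulrCA ler_wpM2l// CK.
Qed.

Let derivative_hermite_transform (n : nat) (y : R) :
  derivable (hermite_transform n) y 1 /\
  (hermite_transform n)^`()%classic y = hermite_transform n.+1 y.
Proof.
(* Derivatives at [y] are local: the domination is only sought on
   [`]y - 1, y + 1[], where [|z| <= |y| + 1]. *)
have [C C0 CK] := hermite_kernel_bound n.+1 (`|y| + 1).
pose f z x := G x * hermite_kernel n z x.
have df (z x : R) : is_derive z 1 (f ^~ x) (G x * hermite_kernel n.+1 z x).
  exact: (is_deriveZ (G x) (is_derive_hermite_kernel n x z)).
have d1f z x : partial1of2 f z x = G x * hermite_kernel n.+1 z x.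
  by rewrite partial1of2E derive_val.
pose H x := C * (`|G x| * (expR ((`|y| + 1 + 1) * `|x|) * normal_pdf 0 1 x)).
have H0 x : 0 <= H x by rewrite !mulr_ge0 ?expR_ge0 ?normal_pdf_ge0.
have intH : mu.-integrable setT (EFin \o H).
  have := integrable_mul_expR_normal_pdf (`|y| + 1 + 1) LG.
  by move=> /(integrableZl measurableT C).
have yI : `](y - 1), (y + 1)[%classic y by rewrite /= in_itv/=; lra.
have fH z x : `](y - 1), (y + 1)[%classic z -> setT x ->
    `|partial1of2 f z x| <= H x.
  rewrite /= in_itv/= => /andP[yz zy] _; rewrite d1f normrM /H mulrCA.
  rewrite ler_wpM2l// CK//.
  have : `|z - y| <= 1 by rewrite ler_norml; lra.
  have := ler_normD (z - y) y; rewrite subrK; lra.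
have intf z : `](y - 1), (y + 1)[%classic z ->
    mu.-integrable setT (EFin \o f z).
  by move=> _; exact: integrable_mul_hermite_kernel.
have derf z x : `](y - 1), (y + 1)[%classic z -> setT x ->
    derivable (f ^~ x) z 1.
  by move=> _ _; exact: ex_derive.
split.
  exact: (derivable_under_integral measurableT yI intf derf H0 intH fH).
rewrite (differentiation_under_integral measurableT yI intf derf H0 intH fH).
by apply: eq_Rintegral => x _; rewrite d1f.
Qed.

Lemma derivable_hermite_transform n y : derivable (hermite_transform n) y 1.
Proof. by have [] := derivative_hermite_transform n y. Qed.

Lemma derive1_hermite_transform n :
  (hermite_transform n)^`()%classic = hermite_transform n.+1.
Proof. by apply/funext => y; have [] := derivative_hermite_transform n y. Qed.

Lemma derive1n_hermite_transform n :
  (hermite_transform 0)^`(n)%classic = hermite_transform n.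
Proof.
elim: n => [|n ih]; first by rewrite derive1n0.
by rewrite derive1nS ih derive1_hermite_transform.
Qed.

End hermite_transform.

(** * Power rank and Hermite rank *)

Lemma hermite_kernel0 (R : realType) (y x : R) :
  hermite_kernel 0 y x = normal_pdf y 1 x.
Proof. by rewrite /hermite_kernel hornerC mul1r. Qed.

Section standard_gaussian_moments.
Context (R : realType) d (T : measurableType d) (P : probability T R).
Variables (Y : {RV P >-> R}) (G : R -> R).
Hypotheses (gY : standard_gaussian Y) (LG : G \in Lfun (gauss R) 2%:E).

Let mG : measurable_fun setT G := measurable_fun_Lfun LG.

Lemma Lfun_comp_standard_gaussian : G \o Y \in Lfun P 2%:E.
Proof.
rewrite inE; apply/andP; split.
  by rewrite inE; exact: measurableT_comp.
have /sub_Lfun_finLfun := LG.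
rewrite !inE /finite_norm unlock; apply: le_lt_trans.
rewrite le_eqVlt; apply/orP; left; apply/eqP; congr poweR.
have mGp : measurable_fun setT (fun x => `|(G x)%:E| `^ 2)%E.
  apply: (measurableT_comp (measurable_poweR _)).
  by apply: measurableT_comp => //; exact/measurable_EFinP.
rewrite [RHS]integral_normal_prob// -(integral_standard_gaussian gY 0 mGp).
by apply: eq_integral => w _; rewrite /= addr0.
Qed.

Lemma integrable_shift_standard_gaussian (y : R) :
  P.-integrable setT (fun w => (G (Y w + y))%:E).
Proof.
have intG := integrable_mul_hermite_kernel LG 0 y.
have mEG : measurable_fun setT (EFin \o G) by exact/measurable_EFinP.
apply: (integrable_standard_gaussian gY mEG).
by move: intG; under eq_fun do rewrite hermite_kernel0 EFinM.
Qed.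

Lemma shifted_mean_hermite_transform :
  shifted_mean Y G = hermite_transform G 0.
Proof.
apply/funext => y; rewrite /shifted_mean unlock.
have mEG : measurable_fun setT (EFin \o G) by exact/measurable_EFinP.
rewrite (integral_standard_gaussian gY y mEG).
congr fine; apply: eq_integral => x _.
by rewrite hermite_kernel0 EFinM.
Qed.

Lemma integral_hermite (n : nat) :
  (\int[gauss R]_x (G x * hermite n x)%:E)%E = (hermite_transform G n 0)%:E.
Proof.
rewrite integral_normal_prob.
  rewrite /hermite_transform /Rintegral fineK.
    apply: eq_integral => x _.
    by rewrite hermiteE /hermite_kernel subr0 -EFinM mulrA.
  exact: integrable_fin_num (integrable_mul_hermite_kernel LG n 0).
apply/measurable_EFinP/measurable_funM => //.
rewrite (_ : hermite n = horner (hermite_poly R n)).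
  exact: measurable_horner.
by apply/funext => x; rewrite hermiteE.
Qed.

End standard_gaussian_moments.

Theorem proposition4p1 (R : realType) (d : measure_display)
    (T : measurableType d) (P : probability T R) (Y : {RV P >-> R})
    (G : R -> R) :
  standard_gaussian Y -> G \in Lfun (gauss R) 2%:E ->
  has_power_rank Y G /\ power_rank Y G = hermite_rank G.
Proof.
move=> gY LG; rewrite /has_power_rank /power_rank /hermite_rank.
rewrite (shifted_mean_hermite_transform gY LG); split.
  split=> [|y|n y].
  - exact: Lfun_comp_standard_gaussian.
  - exact: integrable_shift_standard_gaussian.
  - by rewrite derive1n_hermite_transform//; exact: derivable_hermite_transform.
congr rank; apply/funext => m.
by rewrite derive1n_hermite_transform// integral_hermite.
Qed.
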